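(* Let $p$ be a prime number, let $G,H$ and $A$ be finite cyclic $p$-groups with $|G|\ge|H|$, let $U\le G\times H$ and let $\phi:U\to A$ be a homomorphism such that $p_1(U)=G$, $p_2(U)=H$, $\ker(\phi_1)=1$ and $\ker(\phi_2)=1$. Put $K=k_1(U)$ and $L=k_2(U)$, and let $\eta:H/L\to G/K$ be the canonical isomorphism induced by $U$ (that is, $\eta(yL)=xK$ if $(x,y)\in U$). Let $H=\langle h\rangle$ and $G=\langle g\rangle$ with $(g,h)\in U$, and put $\Delta_\eta(G)=\langle(g,h)\rangle\le G\times H$. For $x\in G$ let $\tilde x\in H$ be the unique element with $(x,\tilde x)\in\Delta_\eta(G)$. (i) Suppose $|A|\ge|H|$. Then the homomorphism $L\to A$, $y\mapsto\phi(1,y)$, extends to a homomorphism $\phi_H:H\to A$. Let $\psi_G:G\to A$ be given by $\psi_G(x)=\phi(x,\tilde x)\,\phi_H(\tilde x)^{-1}$. Then the $A$-fibered $(G,H)$-biset $\left(\frac{G\times H}{U,\phi}\right)$ factors as $$\Big(\frac{G\times H}{U,\phi}\Big)\cong \mathrm{Tw}_G^{\psi_G}\,\mathrm{Inf}_{G/K}^G\,\mathrm{Iso}^{\eta}_{G/K,H/L}\,\mathrm{Def}^H_{H/L}\,\mathrm{Tw}_H^{\phi_H}.$$ (ii) Suppose $|A|<|H|$. Set $K_\eta=k_1(\Delta_\eta(G))$, let $\tilde\eta:H\to G/K_\eta$ be the canonical isomorphism induced by $\Delta_\eta(G)$ (so $\tilde\eta(h)=gK_\eta$), and let $\tilde\phi:G\to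 A$ be the homomorphism with $\tilde\phi(g)=\phi(g,h)$. Then $$\Big(\frac{G\times H}{U,\phi}\Big)\cong \mathrm{Tw}_G^{\tilde\phi}\,\mathrm{Inf}_{G/K_\eta}^G\,\mathrm{Iso}^{\tilde\eta}_{G/K_\eta,H}\,E^H_{(L,\phi_2)}.$$
   Context: For finite groups $G,H$ and an abelian group $A$, an $A$-fibered $(G,H)$-biset is a $(G,H)$-biset with a commuting $A$-action that is free with finitely many orbits; it is viewed as a left $A\times G\times H$-set via $(g,h)x=gxh^{-1}$. For $U\le G\times H$ and $\phi\in\mathrm{Hom}(U,A)$, $\left(\frac{G\times H}{U,\phi}\right)$ is the transitive $A$-fibered $(G,H)$-biset having an $A$-orbit $Ay$ with stabilizer $U$ in $G\times H$ and $(g,h)y=\phi(g,h)y$ for $(g,h)\in U$. Products of fibered bisets are tensor products: $X\otimes_{AH}Y$ consists of the free $A$-orbits in the quotient of $X\times Y$ by $(x\cdot(a,h),y)\sim(x,(a,h)\cdot y)$, $(a,h)\in A\times H$. For $U\le G\times H$: $p_1(U),p_2(U)$ are the projections to $G$ and $H$; $k_1(U)=\{g\in G:(g,1)\in U\}$, $k_2(U)=\{h\in H:(1,h)\in U\}$. The homomorphisms $\phi_1:k_1(U)\to A$ and $\phi_2:k_2(U)\to A$ are defined by $\phi(k,l)=\phi_1(k)\phi_2(l)^{-1}$ for $k\in k_1(U)$, $l\in k_2(U)$. Basic fibered bisets: for $N\unlhd G$, $\mathrm{Inf}_{G/N}^G$ and $\mathrm{Def}^G_{G/N}$ are the set $G/N$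 regarded as a $(G,G/N)$-biset, resp. a $(G/N,G)$-biset; for an isomorphism $\lambda:G'\to G$, $\mathrm{Iso}^\lambda_{G,G'}$ is the set $G$ with left multiplication by $G$ and right multiplication by $G'$ through $\lambda$. These ordinary bisets $X$ are regarded as $A$-fibered bisets $A\times X$ (trivial fiber homomorphism). For $\phi\in\mathrm{Hom}(G,A)$, the twist is $\mathrm{Tw}_G^\phi=\left(\frac{G\times G}{\Delta(G),\Delta_\phi}\right)$, with $\Delta(G)$ the diagonal subgroup and $\Delta_\phi(g,g)=\phi(g)$. For $H$ abelian, $L\le H$ and $\lambda\in\mathrm{Hom}(L,A)$, $E^H_{(L,\lambda)}=\left(\frac{H\times H}{\Delta_L(H),\phi_\lambda}\right)$, where $\Delta_L(H)=\{(x,y)\in H\times H:xL=yL\}$ and $\phi_\lambda(x,y)=\lambda(xy^{-1})$. *)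

(* Defs.v *)
From HB Require Import structures.
From mathcomp Require Import all_boot all_fingroup all_solvable.

Set Implicit Arguments.
Unset Strict Implicit.
Unset Printing Implicit Defensive.

Local Open Scope group_scope.

(* A group is the whole of a finGroupType, so that subgroups of G x H have
   type {group (G * H)} and the quotient by a normal N is the whole type
   coset_of N. *)

Record finAbGroup := FinAbGroup {
  ab_sort :> finGroupType;
  ab_abelian : abelian [set: ab_sort] }.

Lemma abC (A : finAbGroup) (a b : A) : a * b = b * a.
Proof. by have /centsP := ab_abelian A; apply; rewrite inE. Qed.

(* MathComp's actions are right actions, whence the explicit laws. *)
Record biset (G H : finGroupType) := Biset {
  bcar :> finType;
  lact : G -> bcar -> bcar;
  ract : bcar -> H -> bcar;
  lact1 : forall x, lact 1 x = x;
  lactM : forall g g' x, lact (g * g') x = lact g (lact g' x);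
  ract1 : forall x, ract x 1 = x;
  ractM : forall x h h', ract x (h * h') = ract (ract x h) h';
  lractA : forall g x h, lact g (ract x h) = ract (lact g x) h }.

(* For finite A, G and H, having finitely many A-orbits amounts to being
   finite. *)
Record fbiset (A : finAbGroup) (G H : finGroupType) := FBiset {
  fbase :> biset G H;
  aact : A -> fbase -> fbase;
  aact1 : forall x, aact 1 x = x;
  aactM : forall a b x, aact (a * b) x = aact a (aact b x);
  aact_lact : forall a g x, aact a (lact g x) = lact g (aact a x);
  aact_ract : forall a x h, aact a (ract x h) = ract (aact a x) h;
  aact_free : forall a x, aact a x = x -> a = 1 }.

Definition fbiset_iso (A : finAbGroup) (G H : finGroupType)
    (X Y : fbiset A G H) : Prop :=
  exists f : X -> Y,
    [/\ bijective f,
        forall a x, f (aact a x) = aact a (f x),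
        forall g x, f (lact g x) = lact g (f x)
      & forall x h, f (ract x h) = ract (f x) h].

Notation "X \isoto Y" := (fbiset_iso X Y) (at level 70, no associativity).

Section Tensor.

Variables (A : finAbGroup) (G H K : finGroupType).
Variables (X : fbiset A G H) (Y : fbiset A H K).

(* p = (x.(a,h), y) and q = (x, (a,h).y); this relation is already an
   equivalence. *)
Definition tens_rel (p q : X * Y) : bool :=
  [exists a : A, exists h : H,
    (p.1 == aact a (ract q.1 h)) && (q.2 == aact a (lact h p.2))].

Definition tens_class (p : X * Y) : {set X * Y} := [set q | tens_rel p q].

Definition tens_lmul (g : G) (p : X * Y) : X * Y := (lact g p.1, p.2).
Definition tens_rmul (k : K) (p : X * Y) : X * Y := (p.1, ract p.2 k).
Definition tens_amul (a : A) (p : X * Y) : X * Y := (aact a p.1, p.2).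

(* The A-orbit of the class B is free. *)
Definition tens_free (B : {set X * Y}) : bool :=
  [forall a : A, (tens_amul a @: B == B) ==> (a == 1)].

Definition tens_pred (B : {set X * Y}) : bool :=
  [exists p, B == tens_class p] && tens_free B.

Lemma tens_relP p q :
  reflect (exists a h, p.1 = aact a (ract q.1 h) /\ q.2 = aact a (lact h p.2))
          (tens_rel p q).
Proof.
apply: (iffP existsP) => [[a /existsP[h /andP[/eqP e1 /eqP e2]]]|].
  by exists a, h.
by case=> a [h [e1 e2]]; exists a; apply/existsP; exists h; rewrite e1 -e2 !eqxx.
Qed.

Lemma tens_rel_refl : reflexive tens_rel.
Proof. by move=> p; apply/tens_relP; exists 1, 1; rewrite !aact1 ract1 lact1. Qed.

Lemma tens_rel_sym : symmetric tens_rel.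
Proof.
suff sub p q : tens_rel p q -> tens_rel q p by move=> p q; apply/idP/idP; apply: sub.
case/tens_relP=> a [h [e1 e2]]; apply/tens_relP; exists a^-1, h^-1.
rewrite e1 e2 -aact_ract -!aact_lact -!aactM mulVg !aact1 -lactM -ractM.
by rewrite mulVg mulgV ract1 lact1.
Qed.

Lemma tens_rel_trans : transitive tens_rel.
Proof.
move=> q p r /tens_relP[a [h [e1 e2]]] /tens_relP[b [h' [e3 e4]]].
apply/tens_relP; exists (a * b), (h' * h); split.
  by rewrite e1 e3 -aact_ract -aactM -ractM.
by rewrite e4 e2 -aact_lact -aactM abC -lactM.
Qed.

Lemma tens_pred_imset (f f' : X * Y -> X * Y) (B : {set X * Y}) :
    cancel f f' -> cancel f' f ->
    (forall p q, tens_rel p q -> tens_rel (f p) (f q)) ->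
    (forall p q, tens_rel p q -> tens_rel (f' p) (f' q)) ->
    (forall a p, tens_amul a (f p) = f (tens_amul a p)) ->
  tens_pred B -> tens_pred (f @: B).
Proof.
move=> fK f'K frel f'rel fa /andP[/existsP[p /eqP eB] /forallP fB].
apply/andP; split.
  apply/existsP; exists (f p); apply/eqP/setP=> q; rewrite inE eB.
  apply/imsetP/idP => [[r + ->]|pq]; first by rewrite inE; apply: frel.
  by exists (f' q); rewrite ?f'K // inE -[p]fK f'rel.
apply/forallP=> a; apply/implyP=> /eqP e; apply: (implyP (fB a)); apply/eqP.
apply: (imset_inj (can_inj fK)); rewrite -[RHS]e -!imset_comp.
by apply: eq_imset => r /=; rewrite fa.
Qed.

Lemma tens_lmul_pred g B : tens_pred B -> tens_pred (tens_lmul g @: B).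
Proof.
have rel g' p q : tens_rel p q -> tens_rel (tens_lmul g' p) (tens_lmul g' q).
  case/tens_relP=> a [h [e1 e2]]; apply/tens_relP; exists a, h.
  by rewrite /= e1 -aact_lact lractA.
apply: (@tens_pred_imset _ (tens_lmul g^-1)) => //.
- by case=> x y; rewrite /tens_lmul /= -lactM mulVg lact1.
- by case=> x y; rewrite /tens_lmul /= -lactM mulgV lact1.
- exact: rel.
- exact: rel.
by move=> a [x y]; rewrite /tens_lmul /tens_amul /= aact_lact.
Qed.

Lemma tens_rmul_pred k B : tens_pred B -> tens_pred (tens_rmul k @: B).
Proof.
have rel k' p q : tens_rel p q -> tens_rel (tens_rmul k' p) (tens_rmul k' q).
  case/tens_relP=> a [h [e1 e2]]; apply/tens_relP; exists a, h.
  by rewrite /= e1 e2 -aact_ract lractA.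
apply: (@tens_pred_imset _ (tens_rmul k^-1)) => //.
- by case=> x y; rewrite /tens_rmul /= -ractM mulgV ract1.
- by case=> x y; rewrite /tens_rmul /= -ractM mulVg ract1.
- exact: rel.
exact: rel.
Qed.

Lemma tens_amul_pred a B : tens_pred B -> tens_pred (tens_amul a @: B).
Proof.
have rel b p q : tens_rel p q -> tens_rel (tens_amul b p) (tens_amul b q).
  case/tens_relP=> c [h [e1 e2]]; apply/tens_relP; exists c, h.
  by rewrite /= e1 -aact_ract -!aactM abC.
apply: (@tens_pred_imset _ (tens_amul a^-1)) => //.
- by case=> x y; rewrite /tens_amul /= -aactM mulVg aact1.
- by case=> x y; rewrite /tens_amul /= -aactM mulgV aact1.
- exact: rel.
- exact: rel.
by move=> b [x y]; rewrite /tens_amul /= -!aactM abC.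
Qed.

Definition tens_car := {B : {set X * Y} | tens_pred B}.

Definition tens_lact g (B : tens_car) : tens_car :=
  exist (fun B => is_true (tens_pred B)) _ (tens_lmul_pred g (valP B)).
Definition tens_ract (B : tens_car) k : tens_car :=
  exist (fun B => is_true (tens_pred B)) _ (tens_rmul_pred k (valP B)).
Definition tens_aact a (B : tens_car) : tens_car :=
  exist (fun B => is_true (tens_pred B)) _ (tens_amul_pred a (valP B)).

Fact tens_lact1 B : tens_lact 1 B = B.
Proof.
apply: val_inj; rewrite /= -[RHS]imset_id.
by apply: eq_imset => -[x y]; rewrite /tens_lmul /= lact1.
Qed.
Fact tens_lactM g g' B :
  tens_lact (g * g') B = tens_lact g (tens_lact g' B).
Proof.
apply: val_inj; rewrite /= -imset_comp.
by apply: eq_imset => -[x y]; rewrite /tens_lmul /= lactM.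
Qed.
Fact tens_ract1 B : tens_ract B 1 = B.
Proof.
apply: val_inj; rewrite /= -[RHS]imset_id.
by apply: eq_imset => -[x y]; rewrite /tens_rmul /= ract1.
Qed.
Fact tens_ractM B k k' :
  tens_ract B (k * k') = tens_ract (tens_ract B k) k'.
Proof.
apply: val_inj; rewrite /= -imset_comp.
by apply: eq_imset => -[x y]; rewrite /tens_rmul /= ractM.
Qed.
Fact tens_lractA g B k :
  tens_lact g (tens_ract B k) = tens_ract (tens_lact g B) k.
Proof. by apply: val_inj; rewrite /= -!imset_comp; apply: eq_imset. Qed.

Definition tens_biset : biset G K :=
  Biset tens_lact1 tens_lactM tens_ract1 tens_ractM tens_lractA.

Fact tens_aact1 B : tens_aact 1 B = B.
Proof.
apply: val_inj; rewrite /= -[RHS]imset_id.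
by apply: eq_imset => -[x y]; rewrite /tens_amul /= aact1.
Qed.
Fact tens_aactM a b B : tens_aact (a * b) B = tens_aact a (tens_aact b B).
Proof.
apply: val_inj; rewrite /= -imset_comp.
by apply: eq_imset => -[x y]; rewrite /tens_amul /= aactM.
Qed.
Fact tens_aact_lact a g B :
  tens_aact a (tens_lact g B) = tens_lact g (tens_aact a B).
Proof.
apply: val_inj; rewrite /= -!imset_comp.
by apply: eq_imset => -[x y]; rewrite /tens_lmul /tens_amul /= aact_lact.
Qed.
Fact tens_aact_ract a B k :
  tens_aact a (tens_ract B k) = tens_ract (tens_aact a B) k.
Proof. by apply: val_inj; rewrite /= -!imset_comp; apply: eq_imset. Qed.
Fact tens_aact_free a B : tens_aact a B = B -> a = 1.
Proof.
case: B => B /= pB; move/(congr1 val) => /= eB.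
case/andP: (pB) => _ /forallP/(_ a)/implyP fB.
by apply/eqP/fB; rewrite eB.
Qed.

Definition tensor : fbiset A G K :=
  @FBiset A G K tens_biset tens_aact
    tens_aact1 tens_aactM tens_aact_lact tens_aact_ract tens_aact_free.

End Tensor.

Notation "X \otimes Y" := (tensor X Y) (at level 40, left associativity).

Section Transitive.

Variables (A : finAbGroup) (G H : finGroupType) (U : {group (G * H)}).
Variable phi : {morphism U >-> A}.

(* The stabilizer in A x G x H of the base point y: since u y = phi(u) y for
   u in U, (a, u) fixes y iff a = phi(u)^-1. *)
Definition trans_stab : {set A * (G * H)} :=
  [set t | (t.2 \in U) && (t.1 == (phi t.2)^-1)].

Definition trans_car := {C : {set A * (G * H)} | C \in lcosets trans_stab setT}.

Fact trans_mul_subproof t (C : trans_car) :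
  t *: val C \in lcosets trans_stab setT.
Proof.
have /lcosetsP[s _ ->] := valP C; apply/lcosetsP.
by exists (t * s); rewrite ?inE // lcosetM.
Qed.
Definition trans_mul t (C : trans_car) : trans_car :=
  exist (fun C => is_true (C \in _)) _ (trans_mul_subproof t C).

Fact trans_mul1 C : trans_mul 1 C = C.
Proof. by apply: val_inj; rewrite /= lcoset1. Qed.
Fact trans_mulM t s C : trans_mul (t * s) C = trans_mul t (trans_mul s C).
Proof. by apply: val_inj; rewrite /= lcosetM. Qed.

Definition trans_lact g C := trans_mul (1, (g, 1)) C.
Definition trans_ract C h := trans_mul (1, (1, h^-1)) C.
Definition trans_aact a C := trans_mul (a, (1, 1)) C.

Fact trans_lact1 C : trans_lact 1 C = C. Proof. exact: trans_mul1. Qed.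
Fact trans_lactM g g' C : trans_lact (g * g') C = trans_lact g (trans_lact g' C).
Proof.
by rewrite /trans_lact -trans_mulM; congr trans_mul; do 2?congr pair; rewrite /= mulg1.
Qed.
Fact trans_ract1 C : trans_ract C 1 = C.
Proof. by rewrite /trans_ract invg1 trans_mul1. Qed.
Fact trans_ractM C h h' : trans_ract C (h * h') = trans_ract (trans_ract C h) h'.
Proof.
rewrite /trans_ract -trans_mulM; congr trans_mul.
by do 2?congr pair; rewrite /= ?invMg ?mulg1.
Qed.
Fact trans_lractA g C h :
  trans_lact g (trans_ract C h) = trans_ract (trans_lact g C) h.
Proof.
rewrite /trans_ract /trans_lact -!trans_mulM; congr trans_mul.
by do 2?congr pair; rewrite /= ?mulg1 ?mul1g.
Qed.

Definition trans_biset : biset G H :=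
  Biset trans_lact1 trans_lactM trans_ract1 trans_ractM trans_lractA.

Fact trans_aact1 C : trans_aact 1 C = C. Proof. exact: trans_mul1. Qed.
Fact trans_aactM a b C : trans_aact (a * b) C = trans_aact a (trans_aact b C).
Proof.
by rewrite /trans_aact -trans_mulM; congr trans_mul; do 2?congr pair; rewrite /= mulg1.
Qed.
Fact trans_aact_lact a g C :
  trans_aact a (trans_lact g C) = trans_lact g (trans_aact a C).
Proof.
rewrite /trans_aact /trans_lact -!trans_mulM; congr trans_mul.
by do 2?congr pair; rewrite /= ?mulg1 ?mul1g.
Qed.
Fact trans_aact_ract a C h :
  trans_aact a (trans_ract C h) = trans_ract (trans_aact a C) h.
Proof.
rewrite /trans_aact /trans_ract -!trans_mulM; congr trans_mul.
by do 2?congr pair; rewrite /= ?mulg1 ?mul1g.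
Qed.
Fact trans_aact_free a C : trans_aact a C = C -> a = 1.
Proof.
have /lcosetsP[s _ eC] := valP C; move/(congr1 val) => /=; rewrite eC -lcosetM => e.
have: (a, (1, 1)) * s \in s *: trans_stab.
  rewrite -e; apply/lcosetP; exists 1; rewrite ?mulg1 // inE group1 /=.
  by rewrite morph1 invg1.
rewrite mem_lcoset inE; case: s {eC e} => b u.
have -> : (b, u)^-1 * ((a, (1, 1)) * (b, u)) = (a, 1).
  by congr pair; rewrite /= ?(abC a) ?mulKg // mul1g mulVg.
by rewrite /= morph1 invg1 => /andP[_ /eqP].
Qed.

Definition trans : fbiset A G H :=
  @FBiset A G H trans_biset trans_aact
    trans_aact1 trans_aactM trans_aact_lact trans_aact_ract trans_aact_free.

Lemma transP : exists y : trans,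
  [/\ forall x : trans, exists a g h, x = aact a (lact g (ract y h^-1)),
      forall g h,
        (g, h) \in U <-> exists a, lact g (ract y h^-1) = aact a y
    & forall g h, (g, h) \in U -> lact g (ract y h^-1) = aact (phi (g, h)) y].
Proof.
have y_proof : trans_stab \in lcosets trans_stab setT.
  by apply/lcosetsP; exists 1; rewrite ?inE // lcoset1.
pose y : trans := exist (fun C => is_true (C \in _)) _ y_proof.
have actE a g h : aact a (lact g (ract y h^-1)) = trans_mul (a, (g, h)) y.
  rewrite /= /trans_aact /trans_lact /trans_ract -!trans_mulM.
  by congr trans_mul; do 2?congr pair; rewrite /= ?invgK ?mulg1 ?mul1g.
have actU g h : (g, h) \in U -> lact g (ract y h^-1) = aact (phi (g, h)) y.
  move=> Ugh; rewrite -[LHS]aact1 actE; apply: val_inj => /=.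
  apply/setP=> -[b u]; rewrite !mem_lcoset !inE /=.
  have -> : ((1, 1) : G * H)^-1 * u = u by rewrite [_^-1]invg1 [LHS]mul1g.
  rewrite groupMl ?groupV // invg1 mul1g.
  case Uu: (u \in U) => //=; rewrite morphM ?groupV // morphV //.
  rewrite invMg invgK [X in b == X]abC.
  by rewrite -[LHS](inj_eq (mulgI (phi (g, h))^-1)) mulKg.
exists y; split=> [x|g h|//].
  have /lcosetsP[[a [g h]] _ ex] := valP x; exists a, g, h.
  by rewrite actE; apply: val_inj.
split=> [Ugh|[a /(congr1 (aact a^-1))]].
  by exists (phi (g, h)); apply: actU.
rewrite -aactM mulVg aact1 actE => /(congr1 val) /= e.
have: (a^-1, (g, h)) \in trans_stab.
  rewrite -e; apply/lcosetP; exists 1; rewrite ?mulg1 // inE group1 /=.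
  by rewrite morph1 invg1.
by rewrite inE => /andP[].
Qed.

End Transitive.

Section Projections.

Variables (G H : finGroupType).

Definition p1 (U : {set G * H}) : {set G} := [set u.1 | u in U].
Definition p2 (U : {set G * H}) : {set H} := [set u.2 | u in U].

Variable U : {group (G * H)}.

Fact k1_group_set : group_set [set x : G | (x, 1) \in U].
Proof.
apply/group_setP; split=> [|x y]; rewrite !inE; first exact: group1.
by move=> Ux Uy; have := groupM Ux Uy; rewrite -[_ * _]/(_, _) /= mulg1.
Qed.
Definition k1 : {group G} := Group k1_group_set.

Fact k2_group_set : group_set [set y : H | (1, y) \in U].
Proof.
apply/group_setP; split=> [|x y]; rewrite !inE; first exact: group1.
by move=> Ux Uy; have := groupM Ux Uy; rewrite -[_ * _]/(_, _) /= mulg1.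
Qed.
Definition k2 : {group H} := Group k2_group_set.

Lemma p1P x : reflect (exists y, (x, y) \in U) (x \in p1 U).
Proof.
apply: (iffP imsetP) => [[[x' y] Uxy ->]|[y Uxy]]; first by exists y.
by exists (x, y).
Qed.

Lemma p2P y : reflect (exists x, (x, y) \in U) (y \in p2 U).
Proof.
apply: (iffP imsetP) => [[[x y'] Uxy ->]|[x Uxy]]; first by exists x.
by exists (x, y).
Qed.

Hypotheses (U1 : p1 U = [set: G]) (U2 : p2 U = [set: H]).

Lemma k1_normal : k1 <| [set: G].
Proof.
rewrite /normal subsetT /=; apply/subsetP=> x _; rewrite inE.
apply/subsetP=> _ /imsetP[k + ->]; rewrite !inE => Uk.
have /p1P[y Uxy]: x \in p1 U by rewrite U1 inE.
have -> : (k ^ x, 1) = (k, 1) ^ (x, y).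
  by rewrite [RHS]/conjg; congr pair; rewrite /= mul1g mulVg.
exact: groupJ.
Qed.

Lemma k2_normal : k2 <| [set: H].
Proof.
rewrite /normal subsetT /=; apply/subsetP=> y _; rewrite inE.
apply/subsetP=> _ /imsetP[k + ->]; rewrite !inE => Uk.
have /p2P[x Uxy]: y \in p2 U by rewrite U2 inE.
have -> : (1, k ^ y) = (1, k) ^ (x, y).
  by rewrite [RHS]/conjg; congr pair; rewrite /= mul1g mulVg.
exact: groupJ.
Qed.

End Projections.

Section FiberMorphisms.

Variables (A : finAbGroup) (G H : finGroupType) (U : {group (G * H)}).
Variable phi : {morphism U >-> A}.

Definition phi1_fun (k : G) : A := phi (k, 1).
Definition phi2_fun (l : H) : A := (phi (1, l))^-1.

Fact phi1M : {in k1 U &, {morph phi1_fun : x y / x * y}}.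
Proof.
move=> x y; rewrite !inE /phi1_fun => Ux Uy; rewrite -morphM //.
by rewrite -[(x, 1) * _]/(_, _) /= mulg1.
Qed.
Fact phi2M : {in k2 U &, {morph phi2_fun : x y / x * y}}.
Proof.
move=> x y; rewrite !inE /phi2_fun => Ux Uy; rewrite -invMg abC -morphM //.
by rewrite -[(1, x) * _]/(_, _) /= mulg1.
Qed.

Definition phi1 : {morphism k1 U >-> A} := Morphism phi1M.
Definition phi2 : {morphism k2 U >-> A} := Morphism phi2M.

Lemma phi12E k l :
  k \in k1 U -> l \in k2 U -> phi (k, l) = phi1 k * (phi2 l)^-1.
Proof.
rewrite !inE /= /phi1_fun /phi2_fun invgK => Uk Ul; rewrite -morphM //.
by congr (phi _); congr pair; rewrite /= ?mulg1 ?mul1g.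
Qed.

End FiberMorphisms.

Section Fiber.

Variables (A : finAbGroup) (G H : finGroupType) (X : biset G H).

Definition fib_car := (A * X)%type.
Definition fib_lact g (u : fib_car) : fib_car := (u.1, lact g u.2).
Definition fib_ract (u : fib_car) h : fib_car := (u.1, ract u.2 h).
Definition fib_aact a (u : fib_car) : fib_car := (a * u.1, u.2).

Fact fib_lact1 u : fib_lact 1 u = u.
Proof. by case: u => a x; rewrite /fib_lact lact1. Qed.
Fact fib_lactM g g' u : fib_lact (g * g') u = fib_lact g (fib_lact g' u).
Proof. by rewrite /fib_lact lactM. Qed.
Fact fib_ract1 u : fib_ract u 1 = u.
Proof. by case: u => a x; rewrite /fib_ract ract1. Qed.
Fact fib_ractM u h h' : fib_ract u (h * h') = fib_ract (fib_ract u h) h'.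
Proof. by rewrite /fib_ract ractM. Qed.
Fact fib_lractA g u h : fib_lact g (fib_ract u h) = fib_ract (fib_lact g u) h.
Proof. by rewrite /fib_lact /fib_ract lractA. Qed.

Definition fib_biset : biset G H :=
  Biset fib_lact1 fib_lactM fib_ract1 fib_ractM fib_lractA.

Fact fib_aact1 u : fib_aact 1 u = u.
Proof. by case: u => a x; rewrite /fib_aact mul1g. Qed.
Fact fib_aactM a b u : fib_aact (a * b) u = fib_aact a (fib_aact b u).
Proof. by rewrite /fib_aact /= mulgA. Qed.
Fact fib_aact_lact a g u : fib_aact a (fib_lact g u) = fib_lact g (fib_aact a u).
Proof. by []. Qed.
Fact fib_aact_ract a u h : fib_aact a (fib_ract u h) = fib_ract (fib_aact a u) h.
Proof. by []. Qed.
Fact fib_aact_free a u : fib_aact a u = u -> a = 1.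
Proof. by case: u => b x [/(congr1 (fun c => c * b^-1))]; rewrite mulgK mulgV. Qed.

Definition fib : fbiset A G H :=
  @FBiset A G H fib_biset fib_aact
    fib_aact1 fib_aactM fib_aact_lact fib_aact_ract fib_aact_free.

End Fiber.

Section InflationDeflation.

Variables (G : finGroupType) (N : {group G}).
Hypothesis nN : N <| [set: G].

Fact coset_mul x y : coset N (x * y) = coset N x * coset N y.
Proof. by rewrite morphM // (subsetP (normal_norm nN)) ?inE. Qed.

Definition inf_lact (x : G) (c : coset_of N) : coset_of N := coset N x * c.
Definition inf_ract (c d : coset_of N) : coset_of N := c * d.

Fact inf_lact1 c : inf_lact 1 c = c.
Proof. by rewrite /inf_lact morph1 mul1g. Qed.
Fact inf_lactM x y c : inf_lact (x * y) c = inf_lact x (inf_lact y c).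
Proof. by rewrite /inf_lact coset_mul mulgA. Qed.
Fact inf_ract1 c : inf_ract c 1 = c. Proof. exact: mulg1. Qed.
Fact inf_ractM c d d' : inf_ract c (d * d') = inf_ract (inf_ract c d) d'.
Proof. exact: mulgA. Qed.
Fact inf_lractA x c d : inf_lact x (inf_ract c d) = inf_ract (inf_lact x c) d.
Proof. exact: mulgA. Qed.

Definition inf_biset : biset G (coset_of N) :=
  Biset inf_lact1 inf_lactM inf_ract1 inf_ractM inf_lractA.

Definition def_lact (d c : coset_of N) : coset_of N := d * c.
Definition def_ract (c : coset_of N) (x : G) : coset_of N := c * coset N x.

Fact def_lact1 c : def_lact 1 c = c. Proof. exact: mul1g. Qed.
Fact def_lactM d d' c : def_lact (d * d') c = def_lact d (def_lact d' c).
Proof. exact/esym/mulgA. Qed.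
Fact def_ract1 c : def_ract c 1 = c.
Proof. by rewrite /def_ract morph1 mulg1. Qed.
Fact def_ractM c x y : def_ract c (x * y) = def_ract (def_ract c x) y.
Proof. by rewrite /def_ract coset_mul mulgA. Qed.
Fact def_lractA d c x : def_lact d (def_ract c x) = def_ract (def_lact d c) x.
Proof. exact: mulgA. Qed.

Definition def_biset : biset (coset_of N) G :=
  Biset def_lact1 def_lactM def_ract1 def_ractM def_lractA.

End InflationDeflation.

Record giso (G' G : finGroupType) := GIso {
  giso_mor : {morphism [set: G'] >-> G};
  giso_isom : isom [set: G'] [set: G] giso_mor }.

Section Isomorphism.

Variables (G G' : finGroupType) (lam : giso G' G).

Definition iso_lact (x y : G) : G := x * y.
Definition iso_ract (y : G) (x' : G') : G := y * giso_mor lam x'.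

Fact iso_lact1 y : iso_lact 1 y = y. Proof. exact: mul1g. Qed.
Fact iso_lactM x x' y : iso_lact (x * x') y = iso_lact x (iso_lact x' y).
Proof. exact/esym/mulgA. Qed.
Fact iso_ract1 y : iso_ract y 1 = y.
Proof. by rewrite /iso_ract morph1 mulg1. Qed.
Fact iso_ractM y x x' : iso_ract y (x * x') = iso_ract (iso_ract y x) x'.
Proof. by rewrite /iso_ract morphM ?inE // mulgA. Qed.
Fact iso_lractA x y x' : iso_lact x (iso_ract y x') = iso_ract (iso_lact x y) x'.
Proof. exact: mulgA. Qed.

Definition iso_biset : biset G G' :=
  Biset iso_lact1 iso_lactM iso_ract1 iso_ractM iso_lractA.

End Isomorphism.

Definition Inf (A : finAbGroup) (G : finGroupType) (N : {group G})
  (nN : N <| [set: G]) : fbiset A G (coset_of N) := fib A (inf_biset nN).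

Definition Def (A : finAbGroup) (G : finGroupType) (N : {group G})
  (nN : N <| [set: G]) : fbiset A (coset_of N) G := fib A (def_biset nN).

Definition Iso (A : finAbGroup) (G G' : finGroupType) (lam : giso G' G) :
  fbiset A G G' := fib A (iso_biset lam).

Section Twist.

Variables (A : finAbGroup) (G : finGroupType).
Variable phi : {morphism [set: G] >-> A}.

Fact diag_group_set : group_set [set u : G * G | u.1 == u.2].
Proof.
apply/group_setP; split=> [|[x y] [x' y']]; rewrite !inE //=.
by move=> /eqP-> /eqP->.
Qed.
Definition diag : {group (G * G)} := Group diag_group_set.

Definition diag_fun (u : G * G) : A := phi u.1.
Fact diag_funM : {in diag &, {morph diag_fun : u v / u * v}}.
Proof. by move=> u v _ _; rewrite /diag_fun morphM ?inE. Qed.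
Definition diag_mor : {morphism diag >-> A} := Morphism diag_funM.

Definition Tw : fbiset A G G := trans diag_mor.

End Twist.

Section EBiset.

Variables (A : finAbGroup) (H : finGroupType) (cH : abelian [set: H]).
Variables (L : {group H}) (lam : {morphism L >-> A}).

Let mulC (x y : H) : x * y = y * x.
Proof. by have /centsP := cH; apply; rewrite inE. Qed.

Lemma eq_lcosetV (x y : H) : (x *: L == y *: L) = (x * y^-1 \in L).
Proof.
apply/eqP/idP => [/lcoset_eqP|xy].
  by rewrite mem_lcoset mulC.
by apply/lcoset_eqP; rewrite mem_lcoset mulC.
Qed.

Fact DeltaL_group_set : group_set [set u : H * H | u.1 *: L == u.2 *: L].
Proof.
apply/group_setP; split=> [|[x y] [x' y']]; rewrite !inE //= !eq_lcosetV.
move=> Lxy Lxy'; rewrite invMg mulgA -(mulgA x) mulC !mulgA.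
by rewrite (mulC y^-1) -mulgA groupM // mulC.
Qed.
Definition DeltaL : {group (H * H)} := Group DeltaL_group_set.

Definition DeltaL_fun (u : H * H) : A := lam (u.1 * u.2^-1).
Fact DeltaL_funM : {in DeltaL &, {morph DeltaL_fun : u v / u * v}}.
Proof.
move=> [x y] [x' y']; rewrite !inE /= !eq_lcosetV /DeltaL_fun /= => Lu Lv.
rewrite -morphM //; congr (lam _); rewrite invMg (mulC y'^-1) !mulgA.
by congr (_ * _); rewrite -!mulgA (mulC x').
Qed.
Definition DeltaL_mor : {morphism DeltaL >-> A} := Morphism DeltaL_funM.

Definition Ebiset : fbiset A H H := trans DeltaL_mor.

End EBiset.

Section Canonical.

Variables (G H : finGroupType) (U : {group (G * H)}).
Hypotheses (U1 : p1 U = [set: G]) (U2 : p2 U = [set: H]).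

Let nK x : x \in 'N(k1 U).
Proof. by rewrite (subsetP (normal_norm (k1_normal U1))) ?inE. Qed.

Let nL y : y \in 'N(k2 U).
Proof. by rewrite (subsetP (normal_norm (k2_normal U2))) ?inE. Qed.

Let exU y : exists x, (x, y) \in U.
Proof. by apply/p2P; rewrite U2 inE. Qed.

(* y |-> xK for any x with (x, y) in U, where K = k1 U; see canon_funE. *)
Definition canon_fun (y : H) : coset_of (k1 U) :=
  coset (k1 U) (odflt 1 [pick x | (x, y) \in U]).

Lemma canon_funE x y : (x, y) \in U -> canon_fun y = coset (k1 U) x.
Proof.
move=> Uxy; rewrite /canon_fun; case: pickP => [x' Ux'y|/(_ x)]; last by rewrite Uxy.
apply/(rcoset_kercosetP (nK x') (nK x)); rewrite mem_rcoset inE.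
have -> : (x' * x^-1, 1) = (x', y) * (x, y)^-1 by congr pair; rewrite /= mulgV.
exact: groupM Ux'y (groupVr Uxy).
Qed.

Fact canon_funM : {in [set: H] &, {morph canon_fun : y y' / y * y'}}.
Proof.
move=> y y' _ _; have [x Ux] := exU y; have [x' Ux'] := exU y'.
rewrite (canon_funE Ux) (canon_funE Ux') -coset_mul ?k1_normal //.
by apply: canon_funE; exact: (groupM Ux Ux').
Qed.
Definition canon_mor : {morphism [set: H] >-> coset_of (k1 U)} :=
  Morphism canon_funM.

Lemma canon_mor_eq1 y : (canon_mor y == 1) = (y \in k2 U).
Proof.
have [x Uxy] := exU y; rewrite /= (canon_funE Uxy).
have -> : (y \in k2 U) = (x \in k1 U).
  have exy : (x, y) = (x, 1) * (1, y) by congr pair; rewrite /= ?mulg1 ?mul1g.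
  rewrite !inE; rewrite {}exy in Uxy.
  by apply/idP/idP => Uz; [rewrite -(groupMr _ Uz)|rewrite -(groupMl _ Uz)].
by apply/eqP/idP => [|/coset_id //]; exact: (coset_idr (nK x)).
Qed.

Lemma canon_mor_im : canon_mor @* [set: H] = [set: coset_of (k1 U)].
Proof.
apply/setP=> c; rewrite [RHS]inE; have [x _ ->] := cosetP c.
have /p1P[y Uxy]: x \in p1 U by rewrite U1 inE.
by apply/morphimP; exists y; rewrite ?inE //= (canon_funE Uxy).
Qed.

Fact canon_isom (kU : k2 U = 1%G) :
  isom [set: H] [set: coset_of (k1 U)] canon_mor.
Proof.
apply/isomP; split; last exact: canon_mor_im.
apply/subsetP=> y /morphpreP[_]; rewrite inE canon_mor_eq1 kU; exact.
Qed.
Definition canon_iso (kU : k2 U = 1%G) : giso H (coset_of (k1 U)) :=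
  GIso (canon_isom kU).

Definition eta_fun (c : coset_of (k2 U)) : coset_of (k1 U) :=
  canon_fun (repr c).

Lemma eta_funE x y :
  (x, y) \in U -> eta_fun (coset (k2 U) y) = coset (k1 U) x.
Proof.
move=> Uxy; rewrite -(canon_funE Uxy) /eta_fun.
set z := repr _; have ez : coset (k2 U) z = coset (k2 U) y by exact: coset_reprK.
have : z * y^-1 \in k2 U by rewrite -mem_rcoset; apply/(rcoset_kercosetP (nL _) (nL _)).
rewrite -canon_mor_eq1 morphM ?inE // morphV ?inE // -eq_mulgV1.
by move/eqP.
Qed.

Fact eta_funM : {in [set: coset_of (k2 U)] &, {morph eta_fun : c d / c * d}}.
Proof.
move=> c d _ _; have [y _ ->] := cosetP c; have [y' _ ->] := cosetP d.
have [x Ux] := exU y; have [x' Ux'] := exU y'.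
rewrite (eta_funE Ux) (eta_funE Ux') -!coset_mul ?k1_normal ?k2_normal //.
by apply: eta_funE; exact: (groupM Ux Ux').
Qed.
Definition eta_mor : {morphism [set: coset_of (k2 U)] >-> coset_of (k1 U)} :=
  Morphism eta_funM.

Fact eta_isom :
  isom [set: coset_of (k2 U)] [set: coset_of (k1 U)] eta_mor.
Proof.
apply/isomP; split.
  apply/subsetP=> c /morphpreP[_]; rewrite !inE /=.
  have [y _ ->] := cosetP c; have [x Uxy] := exU y.
  rewrite (eta_funE Uxy) -(canon_funE Uxy) => e.
  by apply/eqP/coset_id; rewrite -canon_mor_eq1.
apply/setP=> c; rewrite [RHS]inE; have [x _ ->] := cosetP c.
have /p1P[y Uxy]: x \in p1 U by rewrite U1 inE.
by apply/morphimP; exists (coset (k2 U) y); rewrite ?inE //= (eta_funE Uxy).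
Qed.
Definition eta : giso (coset_of (k2 U)) (coset_of (k1 U)) := GIso eta_isom.

(* The y with (x, y) in U, when it is unique. *)
Definition tilde (x : G) : H := odflt 1 [pick y | (x, y) \in U].

Lemma tildeP (kU : k2 U = 1%G) x y : ((x, y) \in U) = (y == tilde x).
Proof.
have : (x, tilde x) \in U.
  rewrite /tilde; case: pickP => //= nU.
  have /p1P[z Uz]: x \in p1 U by rewrite U1 inE.
  by have := nU z; rewrite Uz.
move=> Ux; apply/idP/eqP => [Uxy|->//].
apply/eqP; rewrite eq_mulgV1 -(in_set1 (y * _)) -[[set _]]/(gval 1%G) -kU inE.
have -> : (1, y * (tilde x)^-1) = (x, y) * (x, tilde x)^-1.
  by congr pair; rewrite /= mulgV.
exact: groupM Uxy (groupVr Ux).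
Qed.

End Canonical.

Section Cyclic.

Variables (p : nat) (G H : finGroupType) (g : G) (h : H).
Hypotheses (p_pr : prime p) (genG : [set: G] = <[g]>) (genH : [set: H] = <[h]>).

Lemma p1_cycle : p1 <[(g, h)]> = [set: G].
Proof.
apply/setP=> x; rewrite [RHS]inE; have: x \in <[g]> by rewrite -genG inE.
case/cycleP=> n ->; apply/imsetP; exists ((g, h) ^+ n); first exact: mem_cycle.
by elim: n => // n IHn; rewrite !expgS /= IHn.
Qed.

Lemma p2_cycle : p2 <[(g, h)]> = [set: H].
Proof.
apply/setP=> x; rewrite [RHS]inE; have: x \in <[h]> by rewrite -genH inE.
case/cycleP=> n ->; apply/imsetP; exists ((g, h) ^+ n); first exact: mem_cycle.
by elim: n => // n IHn; rewrite !expgS /= IHn.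
Qed.

Lemma k2_cycle : p.-group [set: G] -> p.-group [set: H] ->
  #|[set: H]| <= #|[set: G]| -> k2 <[(g, h)]> = 1%G.
Proof.
move=> pG pH leHG.
have dvHG : #[h] %| #[g].
  rewrite !orderE -genG -genH.
  move: leHG; have [m ->] := p_natP pG; have [n ->] := p_natP pH.
  by rewrite leq_exp2l ?prime_gt1 //; apply: dvdn_exp2l.
apply/trivGP/subsetP=> y; rewrite !inE => /cycleP[n].
have -> : (g, h) ^+ n = (g ^+ n, h ^+ n).
  by elim: n => // n IHn; rewrite !expgS IHn.
case=> /esym/eqP; rewrite -order_dvdn => gn ->; rewrite -order_dvdn.
exact: dvdn_trans dvHG gn.
Qed.

End Cyclic.

(* Main.v *)
(* A transitive A-fibered (G,H)-biset is determined up to isomorphism by the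
   relation g x0 = a x0 h for a base point x0. When the second factor of a
   tensor product projects onto its left-hand group and the product is free,
   x0 (x) y0 is a base point whose relation is the composite of those of x0
   and y0. Composing the relations of the elementary bisets gives
     (i)  eta(yL) = xK, i.e. (x,y) in U, with value psi_G(x) phi_H(y),
     (ii) the same U = Delta_eta(G) (1 x L), with value
          phi~(x) phi_2(x~ y^-1),
   and both values are phi(x,y), because (x,y) = (x,x~)(1,x~^-1 y) where x~^-1 y
   lies in L. *)
Require Import Defs.
From mathcomp Require Import all_boot all_fingroup all_solvable.

Set Implicit Arguments.
Unset Strict Implicit.
Unset Printing Implicit Defensive.

Local Open Scope group_scope.

(* MathComp's action library also has an [ract]. *)
Local Notation ract := Defs.ract.

(** * Transitive fibered bisets and the relation of a base point *)

Definition orbit_stab {A : finAbGroup} {G H : finGroupType} {X : fbiset A G H}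
    (x0 : X) (S : A -> G -> H -> Prop) : Prop :=
  (forall x, exists a g h, x = aact a (lact g (ract x0 h))) /\
  (forall a g h, lact g x0 = aact a (ract x0 h) <-> S a g h).

Section OrbitStab.

Variables (A : finAbGroup) (G H : finGroupType).
Implicit Types (X Y : fbiset A G H) (S : A -> G -> H -> Prop).

Lemma orbit_stab_ext X (x0 : X) S S' :
  (forall a g h, S a g h <-> S' a g h) -> orbit_stab x0 S -> orbit_stab x0 S'.
Proof.
by move=> eS [orb stab]; split=> // a g h; apply: iff_trans (stab a g h) (eS a g h).
Qed.

(** Cancelling [a], [g'] and [h] from both sides leaves an instance of the relation of [x0]. Hence
    [S] alone decides which translates coincide. *)
Lemma translates_eq X (x0 : X) S : orbit_stab x0 S -> forall a g h a' g' h',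
  aact a (lact g (ract x0 h)) = aact a' (lact g' (ract x0 h')) <->
  S (a^-1 * a') (g'^-1 * g) (h' * h^-1).
Proof.
move=> [_ stab] a g h a' g' h'; apply: iff_trans (stab _ _ _).
rewrite lactM aactM ractM; split=> [e | e].
  rewrite -[in LHS](ract1 x0) -(mulgV h) ractM lractA.
  have -> : lact g (ract x0 h) = aact a^-1 (aact a' (lact g' (ract x0 h'))).
    by rewrite -e -aactM mulVg aact1.
  by rewrite lractA -!aact_lact -!aact_ract -!lractA -lactM mulVg lact1.
have {e} : lact g x0 = lact g' (aact a^-1 (aact a' (ract (ract x0 h') h^-1))).
  by rewrite -e -lactM mulgV lact1.
rewrite lractA => ->; rewrite -aact_lact aact_ract -aactM mulgV aact1.
by rewrite -lractA -!aact_ract -ractM mulVg ract1 -aact_lact.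
Qed.

Lemma orbit_stab_iso X Y (x0 : X) (y0 : Y) S :
  orbit_stab x0 S -> orbit_stab y0 S -> X \isoto Y.
Proof.
move=> Sx Sy.
pose tr (Z : fbiset A G H) (z : Z) (t : A * G * H) :=
  aact t.1.1 (lact t.1.2 (ract z t.2)).
(* Write [u] as any translate of [z] and apply the same triple to [w]. The default is never reached,
   every [u] being a translate; [fE] shows that the choice of triple is immaterial. *)
pose f (Z W : fbiset A G H) (z : Z) (w : W) (u : Z) : W :=
  tr W w (odflt (1, 1, 1) [pick t | u == tr Z z t]).
have fE (Z W : fbiset A G H) (z : Z) (w : W) : orbit_stab z S -> orbit_stab w S ->
    forall t, f Z W z w (tr Z z t) = tr W w t.
  move=> Sz Sw t; rewrite /f; case: pickP => [u /eqP/esym e|/(_ t)]; last by rewrite eqxx.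
  by apply/(translates_eq Sw)/(translates_eq Sz).
have exT (Z : fbiset A G H) (z : Z) : orbit_stab z S -> forall u, exists t, u = tr Z z t.
  by case=> orb _ u; have [a [g [h ->]]] := orb u; exists (a, g, h).
exists (f X Y x0 y0); split.
- exists (f Y X y0 x0) => u.
    by have [t ->] := exT _ _ Sx u; rewrite !fE.
  by have [t ->] := exT _ _ Sy u; rewrite !fE.
- move=> b u; have [[[a g] h] ->] := exT _ _ Sx u; rewrite fE //.
  have e (Z : fbiset A G H) (z : Z) : aact b (tr Z z (a, g, h)) = tr Z z (b * a, g, h) by rewrite /tr aactM.
  by rewrite !e fE.
- move=> b u; have [[[a g] h] ->] := exT _ _ Sx u; rewrite fE //.
  have e (Z : fbiset A G H) (z : Z) : lact b (tr Z z (a, g, h)) = tr Z z (a, b * g, h).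
    by rewrite /tr /= -aact_lact -lactM.
  by rewrite !e fE.
move=> u b; have [[[a g] h] ->] := exT _ _ Sx u; rewrite fE //.
have e (Z : fbiset A G H) (z : Z) : ract (tr Z z (a, g, h)) b = tr Z z (a, g, h * b).
  by rewrite /tr /= -aact_ract -lractA ractM.
by rewrite !e fE.
Qed.

End OrbitStab.

(** * Base points of tensor products *)

Section TensorOrbit.

Variables (A : finAbGroup) (G H K : finGroupType).
Variables (X : fbiset A G H) (Y : fbiset A H K).

Lemma tens_class_eq (p q : X * Y) :
  tens_class p = tens_class q <-> tens_rel p q.
Proof.
split=> [e|pq].
  have: q \in tens_class q by rewrite inE tens_rel_refl.
  by rewrite -e inE.
apply/setP=> r; rewrite !inE; apply/idP/idP; apply: tens_rel_trans => //.
by rewrite tens_rel_sym.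
Qed.

(** Acting on a class means taking its image as a set; this lemma and the next two allow computing
    on a representative instead. Inverse translates supply the preimages. *)
Lemma tens_class_lmul g (p : X * Y) :
  tens_lmul g @: tens_class p = tens_class (tens_lmul g p).
Proof.
apply/setP=> -[x y]; rewrite inE; apply/imsetP/tens_relP => /=.
  case=> -[x' y']; rewrite inE => /tens_relP[a [h [/= -> e]]] [-> ->].
  by exists a, h; rewrite -aact_lact lractA.
case=> a [h [e1 e2]]; exists (lact g^-1 x, y); last first.
  by rewrite /tens_lmul /= -lactM mulgV lact1.
rewrite inE; apply/tens_relP; exists a, h; split=> //=.
by rewrite -lractA aact_lact -e1 -lactM mulVg lact1.
Qed.

Lemma tens_class_rmul k (p : X * Y) :
  tens_rmul k @: tens_class p = tens_class (tens_rmul k p).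
Proof.
apply/setP=> -[x y]; rewrite inE; apply/imsetP/tens_relP => /=.
  case=> -[x' y']; rewrite inE => /tens_relP[a [h [/= -> e]]] [-> ->].
  by exists a, h; rewrite e -aact_ract lractA.
case=> a [h [e1 e2]]; exists (x, ract y k^-1); last first.
  by rewrite /tens_rmul /= -ractM mulVg ract1.
rewrite inE; apply/tens_relP; exists a, h; split=> //=.
by rewrite e2 -aact_ract -lractA -ractM mulgV ract1.
Qed.

Lemma tens_class_amul b (p : X * Y) :
  tens_amul b @: tens_class p = tens_class (tens_amul b p).
Proof.
apply/setP=> -[x y]; rewrite inE; apply/imsetP/tens_relP => /=.
  case=> -[x' y']; rewrite inE => /tens_relP[a [h [/= -> e]]] [-> ->].
  by exists a, h; rewrite -aact_ract -!aactM abC.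
case=> a [h [e1 e2]]; exists (aact b^-1 x, y); last first.
  by rewrite /tens_amul /= -aactM mulgV aact1.
rewrite inE; apply/tens_relP; exists a, h; split=> //=.
by rewrite -aact_ract -aactM abC aactM -e1 -aactM mulVg aact1.
Qed.

(* A special case of the Mackey formula: [Tfull] leaves a single double coset,
   and [free] makes its A-orbit free. *)
Lemma orbit_stab_tensor (x0 : X) (y0 : Y) S T :
    orbit_stab x0 S -> orbit_stab y0 T ->
    (forall h, exists c k, T c h k) ->
    (forall b c h, S b 1 h -> T c h 1 -> b * c = 1) ->
  exists z : X \otimes Y, orbit_stab z
    (fun a g k => exists b c h, [/\ a = b * c, S b g h & T c h k]).
Proof.
move=> [orbX stabX] [orbY stabY] Tfull free.
have relE a g k : tens_rel (lact g x0, y0) (aact a x0, ract y0 k) <->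
    (exists b c h, [/\ a = b * c, S b g h & T c h k]).
  split=> [/tens_relP[b [h /= [e1 e2]]]|[b [c [h [-> Sb Tc]]]]].
    (* The scalar [b] moved across the tensor sign multiplies the value on the left factor and is
       inverted on the right one, so the product of the two values remains [a]. *)
    exists (b * a), b^-1, h; split.
    - by rewrite abC mulKg.
    - by apply/stabX; rewrite e1 -aact_ract -aactM.
    - by apply/stabY; rewrite e2 -aactM mulVg aact1.
  move/stabX: Sb => Sb; move/stabY: Tc => Tc.
  apply/tens_relP; exists c^-1, h => /=; split.
    by rewrite Sb -aact_ract -aactM (abC b) mulKg.
  by rewrite Tc -aactM mulVg aact1.
have z_pred : tens_pred (tens_class (x0, y0)).
  (* If [a] fixes the class, [relE] at [g = k = 1] splits [a] into a product that [free] makes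
     trivial. *)
  apply/andP; split; first by apply/existsP; exists (x0, y0).
  apply/forallP=> a; apply/implyP; rewrite tens_class_amul => /eqP/esym.
  move/tens_class_eq; rewrite /tens_amul /= -[in X in tens_rel X](lact1 x0).
  rewrite -[in X in tens_rel _ X](ract1 y0) => /relE[b [c [h [-> Sb Tc]]]].
  by rewrite (free _ _ _ Sb Tc).
exists (exist (fun B => is_true (tens_pred B)) _ z_pred : X \otimes Y); split.
  move=> [B pB]; have /andP[/existsP[[x y] /eqP eB] _] := pB.
  have [a [g [h ex]]] := orbX x; have [b [h' [k ey]]] := orbY y.
  (* The middle element [h * h'] is moved to the right factor, where [Tfull] lets it pass through
     [y0] as a scalar [c] and a right translation by [l]. *)
  have [c [l /stabY Tc]] := Tfull (h * h').
  exists (a * b * c), g, (l * k); apply: val_inj => /=; rewrite eB.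
  rewrite tens_class_rmul tens_class_lmul tens_class_amul.
  apply/tens_class_eq/tens_relP; exists (c^-1 * b^-1), h => /=; split.
    by rewrite ex -aact_ract -aactM -invMg -(mulgA a) abC mulgK lractA.
  rewrite ey -aact_lact -lactM lractA Tc ractM -aact_ract -!aactM.
  by rewrite mulgKV mulVg aact1.
move=> a g k; apply: iff_trans (relE a g k); apply: iff_trans (tens_class_eq _ _).
split=> [/(congr1 val)|e].
  by rewrite /= tens_class_rmul tens_class_lmul tens_class_amul.
by apply: val_inj; rewrite /= tens_class_rmul tens_class_lmul tens_class_amul.
Qed.

End TensorOrbit.

(** * Relations of the elementary bisets *)

Section BasicOrbits.

Variable A : finAbGroup.

Lemma orbit_stab_trans (G H : finGroupType) (U : {group (G * H)})
    (phi : {morphism U >-> A}) :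
  exists x : trans phi, orbit_stab x
    (fun a g h => (g, h) \in U /\ a = phi (g, h)).
Proof.
have [y [orb stab stabE]] := transP phi.
exists y; split=> [x|a g h].
  by have [a [g [h ->]]] := orb x; exists a, g, h^-1.
have e b : lact g y = aact b (ract y h) <-> lact g (ract y h^-1) = aact b y.
  split=> eb; first by rewrite lractA eb -aact_ract -ractM mulgV ract1.
  by rewrite aact_ract -eb -lractA -ractM mulVg ract1.
apply: iff_trans (e a) _; split=> [eb|[Ugh ->]]; last exact: stabE.
have Ugh : (g, h) \in U by apply/stab; exists a.
(* Freeness of the [A]-action forces the value: both [a] and [phi (g, h)] carry [y] to the same
   point. *)
split=> //; apply/eqP; rewrite eq_mulVg1; apply/eqP.
apply: (@aact_free _ _ _ _ _ y).
by rewrite aactM -stabE // eb -aactM mulVg aact1.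
Qed.

Lemma orbit_stab_Tw (G : finGroupType) (phi : {morphism [set: G] >-> A}) :
  exists x : Tw phi, orbit_stab x (fun a g h => g = h /\ a = phi g).
Proof.
have [x Sx] := orbit_stab_trans (diag_mor phi); exists x.
apply: orbit_stab_ext Sx => a g h; rewrite inE /= /diag_fun /=.
by split=> [[/eqP]|[->]].
Qed.

Lemma orbit_stab_fib (G H : finGroupType) (X : biset G H) (x0 : X) :
    (forall x, exists g h, x = lact g (ract x0 h)) ->
  orbit_stab ((1, x0) : fib A X)
    (fun a g h => a = 1 /\ lact g x0 = ract x0 h).
Proof.
move=> orb; split=> [[a x]|a g h].
  have [g [h ->]] := orb x; exists a, g, h.
  by rewrite /= /fib_aact /fib_lact /fib_ract /= mulg1.
rewrite /= /fib_aact /fib_lact /fib_ract /= mulg1.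
by split=> [[<- ->]|[-> ->]].
Qed.

Lemma orbit_stab_Inf (G : finGroupType) (N : {group G}) (nN : N <| [set: G]) :
  exists x : Inf A nN, orbit_stab x (fun a g c => a = 1 /\ coset N g = c).
Proof.
exists (1, 1); apply: orbit_stab_ext (orbit_stab_fib _).
  by move=> a g c; rewrite /= /inf_lact /inf_ract mulg1 mul1g.
by move=> c; exists 1, c; rewrite /= inf_lact1 /inf_ract mul1g.
Qed.

Lemma orbit_stab_Def (G : finGroupType) (N : {group G}) (nN : N <| [set: G]) :
  exists x : Def A nN, orbit_stab x (fun a c g => a = 1 /\ c = coset N g).
Proof.
exists (1, 1); apply: orbit_stab_ext (orbit_stab_fib _).
  by move=> a c g; rewrite /= /def_lact /def_ract mulg1 mul1g.
by move=> c; exists c, 1; rewrite /= def_ract1 /def_lact mulg1.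
Qed.

Lemma orbit_stab_Iso (G G' : finGroupType) (lam : giso G' G) :
  exists x : Iso A lam, orbit_stab x (fun a x y => a = 1 /\ x = giso_mor lam y).
Proof.
exists (1, 1); apply: orbit_stab_ext (orbit_stab_fib _).
  by move=> a x y; rewrite /= /iso_lact /iso_ract mulg1 mul1g.
by move=> x; exists x, 1; rewrite /= iso_ract1 /iso_lact mulg1.
Qed.

Lemma orbit_stab_E (H : finGroupType) (cH : abelian [set: H]) (L : {group H})
    (lam : {morphism L >-> A}) :
  exists x : Ebiset cH lam, orbit_stab x
    (fun a y z => y * z^-1 \in L /\ a = lam (y * z^-1)).
Proof.
have [x Sx] := orbit_stab_trans (DeltaL_mor cH lam); exists x.
by apply: orbit_stab_ext Sx => a y z; rewrite inE eq_lcosetV.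
Qed.

Lemma giso_surj (G G' : finGroupType) (lam : giso G' G) x :
  exists y, x = giso_mor lam y.
Proof.
have /isomP[_ im] := giso_isom lam.
have: x \in giso_mor lam @* [set: G'] by rewrite im inE.
by case/morphimP=> y _ _ ->; exists y.
Qed.

(** These three factors begin both factorizations, with [lam] the map [eta] in (i) and the canonical
    isomorphism of [D] in (ii). Only the twist contributes a nontrivial value. *)
Lemma orbit_stab_TwInfIso (G G' : finGroupType) (N : {group G})
    (nN : N <| [set: G]) (psi : {morphism [set: G] >-> A})
    (lam : giso G' (coset_of N)) :
  exists z : Tw psi \otimes Inf A nN \otimes Iso A lam, orbit_stab z
    (fun a x y => coset N x = giso_mor lam y /\ a = psi x).
Proof.
have [t St] := orbit_stab_Tw psi; have [i Si] := orbit_stab_Inf nN.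
have [j Sj] := orbit_stab_Iso lam.
have [|b c x [<- ->] [-> _]|u Su] := orbit_stab_tensor St Si.
- by move=> x; exists 1, (coset N x).
- by rewrite morph1 mulg1.
have [|b c d [b1 [c1 [x [-> [<- ->] [-> _]]]]] [-> _]|v Sv] :=
  orbit_stab_tensor Su Sj.
- by move=> d; have [y ->] := giso_surj lam d; exists 1, y.
- by rewrite morph1 !mulg1.
exists v; apply: orbit_stab_ext Sv => a x y; split.
  case=> b [c [d [-> [b1 [c1 [x' [-> [<- ->] [-> <-]]]]]] [-> ->]]].
  by rewrite !mulg1.
case=> e ->; exists (psi x), 1, (coset N x); split=> //; first by rewrite mulg1.
by exists (psi x), 1, x; rewrite mulg1.
Qed.

End BasicOrbits.

(** * Extension of homomorphisms between cyclic groups *)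

(** With [h] generating [K], [h ^+ m] generating [L] and [f (h ^+ m) = c ^+ k], the map sending [h]
    to [c ^+ i] extends [f] as soon as [k = i * m]. The hypothesis on orders makes [m] divide
    [k]. *)
Lemma cyclic_morph_extend (gT aT : finGroupType) (K L : {group gT})
    (C : {group aT}) (f : {morphism L >-> aT}) :
    cyclic K -> cyclic C -> L \subset K -> f @* L \subset C ->
    #|K| %| #|C| ->
  exists f' : {morphism K >-> aT}, {in L, f' =1 f}.
Proof.
move=> /cyclicP[h eK] /cyclicP[c eC]; rewrite {}eK {}eC => sLK sfC dvd_hc.
pose m := #[h] %/ #|L|.
have mL : (m * #|L|)%N = #[h] by rewrite divnK // orderE cardSg.
have eL : L = <[h ^+ m]>%G.
  have /setP/(_ L) := cycle_sub_group (cardSg sLK).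
  by rewrite !inE sLK eqxx => /esym/eqP.
have Lhm : h ^+ m \in L by rewrite eL cycle_id.
have /cycleP[k fhm] : f (h ^+ m) \in <[c]>.
  by rewrite (subsetP sfC) // mem_morphim.
(* #|C| divides k #|L|, and m #|L| = #|K| divides #|C|. *)
have /dvdnP[i ki] : m %| k.
  rewrite -(dvdn_pmul2r (cardG_gt0 L)) mL (dvdn_trans dvd_hc) //.
  rewrite order_dvdn expgM -fhm -morphX // -expgM mL expg_order.
  by rewrite morph1.
have dvd_order : #[c ^+ i] %| #[h].
  rewrite order_dvdn -mL -expgM mulnA -ki expgM -fhm -morphX // -expgM mL.
  by rewrite expg_order morph1.
exists (eltm_morphism dvd_order) => y; rewrite {1}eL => /cycleP[j ->].
by rewrite morphX //= fhm -expgM eltmE -!expgM ki mulnA.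
Qed.

(** * Recovering [U] from the maps it induces on quotients *)

Section Correspondence.

Variables (G H : finGroupType) (U : {group (G * H)}).
Hypotheses (U1 : p1 U = [set: G]) (U2 : p2 U = [set: H]).

(** If [x'] is matched with [y] and lies in the coset of [x], then [(x, y)] is the product of
    [(x * x'^-1, 1)] and [(x', y)], both in [U]. *)
Lemma coset_eq_canon_fun x y :
  coset (k1 U) x = canon_fun U y <-> (x, y) \in U.
Proof.
split=> [|Uxy]; last by rewrite (canon_funE U1 Uxy).
have nK z : z \in 'N(k1 U).
  by rewrite (subsetP (normal_norm (k1_normal U1))) ?inE.
have /p2P[x' Ux'y] : y \in p2 U by rewrite U2 inE.
rewrite (canon_funE U1 Ux'y) => /(rcoset_kercosetP (nK _) (nK _)).
rewrite mem_rcoset inE => Uk.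
have -> : (x, y) = (x * x'^-1, 1) * (x', y).
  by congr pair; rewrite /= ?mulgKV ?mul1g.
exact: groupM.
Qed.

Lemma eta_fun_coset y : eta_fun (coset (k2 U) y) = canon_fun U y.
Proof.
have /p2P[x Uxy] : y \in p2 U by rewrite U2 inE.
by rewrite (eta_funE U1 U2 Uxy) (canon_funE U1 Uxy).
Qed.

End Correspondence.

(** * Splitting [U] along the graph [D] *)

Section Tilde.

Variables (A : finAbGroup) (G H : finGroupType) (U D : {group (G * H)}).
Variable phi : {morphism U >-> A}.
Hypotheses (D1 : p1 D = [set: G]) (kD : k2 D = 1%G) (sDU : D \subset U).

Lemma tilde_in x : (x, tilde D x) \in D.
Proof. by rewrite (tildeP D1 kD). Qed.

Lemma tildeM : {in [set: G] &, {morph tilde D : x y / x * y}}.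
Proof.
move=> x y _ _; apply/esym/eqP; rewrite -(tildeP D1 kD).
exact: (groupM (tilde_in x) (tilde_in y)).
Qed.

Lemma tilde_mem x : (x, tilde D x) \in U.
Proof. exact: subsetP sDU _ (tilde_in x). Qed.

(** This is the twist of (ii); dividing it by [phiH (tilde D x)] gives the twist of (i). *)
Definition phi_tilde x := phi (x, tilde D x).

Lemma phi_tildeM : {in [set: G] &, {morph phi_tilde : x y / x * y}}.
Proof.
move=> x y _ _; rewrite /phi_tilde tildeM ?inE //.
by rewrite -morphM ?tilde_mem.
Qed.

Lemma mem_tilde x y : ((x, y) \in U) = ((tilde D x)^-1 * y \in k2 U).
Proof.
have e : (x, y) = (x, tilde D x) * (1, (tilde D x)^-1 * y).
  by congr pair; rewrite /= ?mulg1 ?mulKVg.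
by rewrite [in LHS]e groupMl ?tilde_mem ?inE.
Qed.

Lemma phi_tildeE x y : (x, y) \in U ->
  phi (x, y) = phi_tilde x * phi (1, (tilde D x)^-1 * y).
Proof.
move=> Uxy; have := Uxy; rewrite mem_tilde inE => Uy.
rewrite -morphM ?tilde_mem //; congr (phi _).
by congr pair; rewrite /= ?mulg1 ?mulKVg.
Qed.

End Tilde.

(** * Assembling the two factorizations *)

Theorem theorem3p4 (p : nat) (G H : finGroupType) (A : finAbGroup)
    (p_pr : prime p)
    (cycG : cyclic [set: G]) (cycH : cyclic [set: H]) (cycA : cyclic [set: A])
    (pG : p.-group [set: G]) (pH : p.-group [set: H]) (pA : p.-group [set: A])
    (leHG : #|[set: H]| <= #|[set: G]|)
    (U : {group (G * H)}) (phi : {morphism U >-> A})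
    (U1 : p1 U = [set: G]) (U2 : p2 U = [set: H])
    (ker1 : 'ker (phi1 phi) = 1) (ker2 : 'ker (phi2 phi) = 1)
    (g : G) (h : H)
    (genG : [set: G] = <[g]>) (genH : [set: H] = <[h]>)
    (Ugh : (g, h) \in U) :
  let L := k2 U in
  let D := <[(g, h)]>%G in
  let D1 : p1 D = [set: G] := p1_cycle h genG in
  let D2 : p2 D = [set: H] := p2_cycle g genH in
  let kD : k2 D = 1%G := k2_cycle p_pr genG genH pG pH leHG in
  (#|[set: H]| <= #|[set: A]| ->
    (exists phiH : {morphism [set: H] >-> A},
       forall y, y \in L -> phiH y = phi (1, y)) /\
    forall phiH : {morphism [set: H] >-> A},
      (forall y, y \in L -> phiH y = phi (1, y)) ->
      exists psiG : {morphism [set: G] >-> A},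
        (forall x, psiG x = phi (x, tilde D x) * (phiH (tilde D x))^-1) /\
        (trans phi \isoto
           Tw psiG \otimes Inf A (k1_normal U1) \otimes Iso A (eta U1 U2)
             \otimes Def A (k2_normal U2) \otimes Tw phiH))
  /\
  (#|[set: A]| < #|[set: H]| ->
    exists phit : {morphism [set: G] >-> A},
      phit g = phi (g, h) /\
      (trans phi \isoto
         Tw phit \otimes Inf A (k1_normal D1)
           \otimes Iso A (canon_iso D1 D2 kD)
           \otimes Ebiset (cyclic_abelian cycH) (phi2 phi))).
Proof.
move=> L D D1 D2 kD.
have sDU : D \subset U by rewrite cycle_subG.
have phiM := phi_tildeM phi D1 kD sDU.
have [t0 St0] := orbit_stab_trans phi.
split=> [leHA | _].
  split.
    (* The homomorphism to extend is the inverse of [phi2 phi], whose definition carries an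
       inversion. *)
    have phiLM : {in L &, {morph (fun y => phi (1, y)) : x y / x * y}}.
      move=> x y; rewrite !inE => Ux Uy; rewrite -morphM //.
      by rewrite -[(1, x) * _]/(_, _) /= mulg1.
    pose phiL := Morphism phiLM.
    (* Between powers of the same prime, the inequality is a divisibility. *)
    have dvd_HA : #|[set: H]| %| #|[set: A]|.
      move: leHA; have [m ->] := p_natP pH; have [n ->] := p_natP pA.
      by rewrite leq_exp2l ?prime_gt1 //; apply: dvdn_exp2l.
    exact: (cyclic_morph_extend (f := phiL) cycH cycA
              (subsetT _) (subsetT _) dvd_HA).
  move=> phiH ephiH.
  pose psi x := phi_tilde D phi x * (phiH (tilde D x))^-1.
  have psiM : {in [set: G] &, {morph psi : x y / x * y}}.
    move=> x y _ _; rewrite /psi phiM ?inE // (tildeM D1 kD) ?inE //.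
    rewrite morphM ?inE // invMg [(phiH (tilde D y))^-1 * _]abC !mulgA.
    by congr (_ * _); rewrite -!mulgA; congr (_ * _); rewrite abC.
  exists (Morphism psiM); split=> //; set psiG := Morphism psiM.
  have [u Su] := orbit_stab_TwInfIso (k1_normal U1) psiG (eta U1 U2).
  have [d Sd] := orbit_stab_Def A (k2_normal U2).
  have [t St] := orbit_stab_Tw phiH.
  have [|b c y [_ ->] [-> _]|v Sv] := orbit_stab_tensor Su Sd.
  - by move=> c; have [y _ ->] := cosetP c; exists 1, y.
  - by rewrite morph1 mulg1.
  have [|b c y [b1 [c1 [d1 [-> [_ ->] [-> _]]]]] [-> ->]|w Sw] :=
    orbit_stab_tensor Sv St.
  - by move=> y; exists (phiH y), y.
  - by rewrite !morph1 !mulg1.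
  apply: orbit_stab_iso St0 (orbit_stab_ext _ Sw) => a x y.
  (* The factor [(phiH (tilde D x))^-1] of [psi x] combines with [phiH y] to the value of [phiH] at
     [(tilde D x)^-1 * y], an element of [L], where [phiH] agrees with [phi (1, _)]. *)
  have e : (x, y) \in U -> psi x * phiH y = phi (x, y).
    move=> Uxy; rewrite (phi_tildeE phi D1 kD sDU Uxy).
    have := Uxy; rewrite (mem_tilde D1 kD sDU) => /ephiH <-.
    by rewrite morphM ?inE // morphV ?inE // mulgA.
  split=> [[b [c [y' [-> [b1 [c1 [d1 [-> [ex ->] [-> ey]]]]] [ey' ->]]]]]|].
    rewrite mulg1.
    have Uxy : (x, y) \in U.
      by apply/(coset_eq_canon_fun U1 U2); rewrite ex ey ey' /= eta_fun_coset.
    by rewrite ey' e.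
  case=> Uxy ->; exists (psi x), (phiH y), y; split=> //; first by rewrite e.
  exists (psi x), 1, (coset (k2 U) y); rewrite mulg1; split=> //; split=> //.
  by rewrite /= eta_fun_coset //; apply/coset_eq_canon_fun.
exists (Morphism phiM); split=> /=.
  rewrite /phi_tilde; congr (phi (_, _)).
  by apply/esym/eqP; rewrite -(tildeP D1 kD) cycle_id.
set phit := Morphism phiM.
have [u Su] := orbit_stab_TwInfIso (k1_normal D1) phit (canon_iso D1 D2 kD).
have [d Sd] := orbit_stab_E (cyclic_abelian cycH) (phi2 phi).
have Dmem x y : (x, y) \in D <-> y = tilde D x.
  by rewrite (tildeP D1 kD); split=> /eqP.
have [|b c y [e ->] [Ly ->]|v Sv] := orbit_stab_tensor Su Sd.
- by move=> y; exists (phi2 phi (y * y^-1)), y; rewrite mulgV group1.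
(* Freeness: the middle element is matched with 1 by the graph [D], so it is 1 and both values are
   trivial. *)
- move/(coset_eq_canon_fun D1 D2)/Dmem: e => ->; rewrite morph1.
  have -> : tilde D 1 = 1 by apply/esym/Dmem/group1.
  by rewrite mulgV morph1 mulg1.
apply: orbit_stab_iso St0 (orbit_stab_ext _ Sv) => a x y.
have invE z : tilde D x * z^-1 = ((tilde D x)^-1 * z)^-1.
  have /centsP cH := cyclic_abelian cycH.
  by rewrite invMg invgK (cH z^-1) ?inE.
have memL z : (tilde D x * z^-1 \in k2 U) = ((x, z) \in U).
  by rewrite (mem_tilde D1 kD sDU) invE groupV.
(* By [invE] the argument of [phi2] is the inverse of [(tilde D x)^-1 * z], and this inversion
   cancels the one in the definition of [phi2]. *)
have e z : (x, z) \in U ->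
    phit x * phi2 phi (tilde D x * z^-1) = phi (x, z).
  move=> Uxz; rewrite (phi_tildeE phi D1 kD sDU Uxz) invE morphV.
    by rewrite /= /phi2_fun invgK.
  by rewrite -(mem_tilde D1 kD sDU).
split=> [[b [c [y' [-> [ex ->] [Ly ->]]]]]|[Uxy ->]].
  move/(coset_eq_canon_fun D1 D2)/Dmem: ex Ly => -> Ly.
  by split; [rewrite -memL | rewrite e -?memL].
(* The middle element can only be [tilde D x], since the isomorphism comes from [D] and not from
   [U]. *)
exists (phit x), (phi2 phi (tilde D x * y^-1)), (tilde D x).
by split; rewrite ?e ?memL //; split=> //; apply/(coset_eq_canon_fun D1 D2)/Dmem.
Qed.
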